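(* Let $T$, $\widehat T$, $D$ and $\widehat{\mathcal L}$ be as described in the context. Then the linear manifold $\widehat{\mathcal L}$ is strongly $D$-normal, which means that for every $r\in\mathbb N$ the subspace $M_{3,r}(\widehat{\mathcal L}_r)\subset M_3[\mathbb C]$ is strongly $\Delta_r$-normal, with parameters $x_r,y_r,q_r\in\mathbb C\setminus\{0\}$. Furthermore, $$x_{r+1}=\frac{y_r}{x_r}\qquad(r\in\mathbb N).$$
   Context: Notation. $\mathbb N=\{1,2,\dots\}$, $\mathbb C_0=\mathbb C\setminus\{0\}$. $\mathcal L(\mathcal K)$ is the algebra of bounded linear operators on a Hilbert space $\mathcal K$; $\{T\}'$ is the commutant of $T$; $\sigma_{\rm p}$ denotes point spectrum, $\sigma$ spectrum, $\rho(B)=\mathbb C\setminus\sigma(B)$. $\mathcal H$ is a complex Hilbert space with a fixed orthonormal basis $\{e_k\}_{k=1}^\infty$, $\mathcal H^{(3)}=\mathcal H\oplus\mathcal H\oplus\mathcal H$, $e_k\otimes e_k$ is the orthogonal projection onto $\mathbb C e_k$, and $S\in\mathcal L(\mathcal H)$ is the unilateral shift $Se_k=e_{k+1}$ ($k\in\mathbb N$). Setting. $\mathcal H_1,\mathcal H_2$ are complex Hilbert spaces of dimension $\aleph_0$ and $T=\begin{bmatrix}A&C\\ 0&B\end{bmatrix}\in\mathcal L(\mathcal H_1\oplus\mathcal H_2)$, where $A$ is similar to $S$, $\sigma_{\rm p}(T^* )=\emptyset$, and $\{T\}'x$ is dense in $\mathcal H_1\oplus\mathcal H_2$ for every nonzero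 $x\in\mathcal H_1$ ($\equiv\mathcal H_1\oplus\{0\}$). Fix $b_0\in\partial\sigma(B)$. $T-b_0I$ is similar to an operator $\widehat T\in\mathcal L(\mathcal H^{(3)})$ of the form $$\widehat T=\begin{bmatrix} S-b_0I&*&* \\ 0&*&* \\ 0&F_*&D_* \end{bmatrix},$$ where $D_*=\sum_{k=1}^\infty(b_k-b_0)e_k\otimes e_k$, $\rho(B)\ni b_k\to b_0$ (fast enough for such a similarity model to be constructed), $\{b_k\}_{k=1}^\infty$ are distinct nonzero complex numbers, and $\operatorname{rank}F_*\le1$. Let $$\widehat{\mathcal L}=\{Q_{3,1}:[Q_{i,j}]_3\in\{\widehat T\}'\}\subset\mathcal L(\mathcal H),\qquad D=D_*+b_0I=\sum_{k=1}^\infty b_k\,e_k\otimes e_k .$$ $\widehat{\mathcal L}$ is transitive (i.e. $\widehat{\mathcal L}x$ is dense in $\mathcal H$ for every nonzero $x\in\mathcal H$) and $\operatorname{rank}(D\widehat X-\widehat XS)\le1$ for every $\widehat X\in\widehat{\mathcal L}$. Cross-sections. For $r\in\mathbb N$ let $\mathcal E_{3,r}$ be the span of $e_r,e_{r+1},e_{r+2}$; $\widehat{\mathcal L}_r\subset\mathcal L(\mathcal E_{3,r})$ is the set of compressions $P_{\mathcal E_{3,r}}\widehat X|_{\mathcal E_{3,r}}$, $\widehat X\in\widehat{\mathcal L}$, with $P_{\mathcal E_{3,r}}$ the orthogonal projection onto $\mathcal E_{3,r}$; $M_{3,r}:\mathcal L(\mathcal E_{3,r})\to M_3[\mathbb C]$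 assigns to an operator its matrix in the basis $(e_r,e_{r+1},e_{r+2})$; and $\Delta_r=\operatorname{diag}(b_r,b_{r+1},b_{r+2})$. Let $\Delta=\operatorname{diag}(b_1,b_2,b_3)$ with (arbitrary) distinct $b_1,b_2,b_3\in\mathbb C_0$, and put $b_\Delta(1)=\frac1{b_3}-\frac1{b_2}$, $b_\Delta(2)=\frac1{b_3}-\frac1{b_1}$, $b_\Delta(3)=\frac1{b_2}-\frac1{b_1}$. (For $\Delta_r$ the formulas below are used with $(b_r,b_{r+1},b_{r+2})$ in place of $(b_1,b_2,b_3)$.) For $x,y\in\mathbb C_0$ write $$L_1=\begin{bmatrix} 1&0&0 \\ x&0&0 \\ y&0&0 \end{bmatrix},\qquad L_2=\begin{bmatrix} 0&1&0 \\ b_\Delta(3)x&x&0 \\ b_\Delta(2)y&y&0 \end{bmatrix}.$$ Strong $\Delta$-normality. A subspace $\mathcal L\subset M_3[\mathbb C]$ is strongly $\Delta$-normal with parameters $x,y,q\in\mathbb C_0$ if $\dim\mathcal L=5$ and $\mathcal L$ has a basis $(L_1,L_2,Q_1,Q_2,Q_3)$ with $L_1,L_2$ as displayed and $$Q_1=\begin{bmatrix} 0&0&1 \\ q/b_2&q&0 \\ -y/(b_1b_3)&-y/b_1&0 \end{bmatrix},\quad Q_2=\begin{bmatrix} 0&0&0 \\ 1/b_2^2&1/b_2&1 \\ 0&0&0 \end{bmatrix},\quad Q_3=\begin{bmatrix} 0&0&0 \\ 0&0&0 \\ 1/b_3^2&1/b_3&1 \end{bmatrix}.$$ Known fact. In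 the setting above it is known from earlier work, and is part of the standing setting, that $\widehat{\mathcal L}$ is $D$-normal, i.e. $M_{3,r}(\widehat{\mathcal L}_r)$ is $\Delta_r$-normal for every $r\in\mathbb N$. Here a subspace $\mathcal L\subset M_3[\mathbb C]$ is $\Delta$-normal if $\dim\mathcal L=5$ and $\mathcal L$ has a basis $(L_1,L_2,Q_1,Q_2,Q_3)$, with $L_1,L_2$ as displayed, of one of the following two types. Type (T1), with parameters $x,y\in\mathbb C_0$: $$Q_1=\begin{bmatrix} 0&0&1 \\ 0&0&0 \\ 0&0&0 \end{bmatrix},\quad Q_2=\begin{bmatrix} 0&0&0 \\ b_\Delta(3)/b_2&b_\Delta(3)&1 \\ 0&0&0 \end{bmatrix},\quad Q_3=\begin{bmatrix} 0&0&0 \\ 0&0&0 \\ b_\Delta(2)/b_3&b_\Delta(2)&1 \end{bmatrix}.$$ Type (T2), with parameters $x,y,q\in\mathbb C_0$ and $q'\in\mathbb C$: $$Q_1=\begin{bmatrix} 0&0&1 \\ q'&q&0 \\ q'y/x+b_\Delta(1)qy/x&qy/x&0 \end{bmatrix},\quad Q_2=\begin{bmatrix} 0&0&0 \\ b_\Delta(3)/b_2-q'/x&b_\Delta(3)-q/x&1 \\ 0&0&0 \end{bmatrix},$$ $$Q_3=\begin{bmatrix} 0&0&0 \\ 0&0&0 \\ b_\Delta(2)/b_3-b_\Delta(1)q/x-q'/x&b_\Delta(2)-q/x&1 \end{bmatrix}.$$ *)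

(* Defs.v *)
From HB Require Import structures.
From mathcomp Require Import all_boot all_order all_algebra.
From mathcomp Require Import complex.
From mathcomp Require Import all_classical all_reals topology normedtype sequences.
From mathcomp Require Import ring.

Set Implicit Arguments.
Unset Strict Implicit.
Unset Printing Implicit Defensive.

Import Order.TTheory GRing.Theory Num.Theory.
Import numFieldNormedType.Exports.

Local Open Scope classical_set_scope.
Local Open Scope ring_scope.

(* The inner product is linear in its first argument; the norm takes values in
   R[i], where the order is that of the reals on real elements. *)
HB.mixin Record NormedModule_hasInner (R : realType) H & NormedModule R[i] H := {
  inner : {dot H for (@Num.conj R[i])} ;
  inner_norm : forall x : H, `|x| ^+ 2 = inner x x
}.

#[short(type="hilbertType")]
HB.structure Definition Hilbert (R : realType) :=
  { H of CompleteNormedModule R[i] H & NormedModule_hasInner R H }.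

Lemma minkowski2 (C : numClosedFieldType) (a b c d : C) :
  0 <= a -> 0 <= b -> 0 <= c -> 0 <= d ->
  sqrtC ((a + c) ^+ 2 + (b + d) ^+ 2) <=
  sqrtC (a ^+ 2 + b ^+ 2) + sqrtC (c ^+ 2 + d ^+ 2).
Proof.
move=> a0 b0 c0 d0.
have p0 : 0 <= sqrtC (a ^+ 2 + b ^+ 2) by rewrite sqrtC_ge0 addr_ge0 ?exprn_ge0.
have q0 : 0 <= sqrtC (c ^+ 2 + d ^+ 2) by rewrite sqrtC_ge0 addr_ge0 ?exprn_ge0.
have CS : a * c + b * d <= sqrtC (a ^+ 2 + b ^+ 2) * sqrtC (c ^+ 2 + d ^+ 2).
  rewrite -(@ler_pXn2r _ 2) ?nnegrE ?addr_ge0 ?mulr_ge0//.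
  rewrite exprMn !sqrtCK -subr_ge0.
  have -> : (a ^+ 2 + b ^+ 2) * (c ^+ 2 + d ^+ 2) - (a * c + b * d) ^+ 2
            = (a * d - b * c) ^+ 2 by ring.
  by rewrite real_exprn_even_ge0// rpredB ?rpredM ?ger0_real.
rewrite -(@ler_pXn2r _ 2) ?nnegrE ?addr_ge0 ?sqrtC_ge0 ?addr_ge0 ?exprn_ge0
  ?addr_ge0//.
rewrite sqrtCK -subr_ge0 [(sqrtC _ + _) ^+ 2]sqrrD !sqrtCK.
set st := sqrtC _ * sqrtC _ in CS *.
have -> : a ^+ 2 + b ^+ 2 + st *+ 2 + (c ^+ 2 + d ^+ 2) -
    ((a + c) ^+ 2 + (b + d) ^+ 2) = (st - (a * c + b * d)) *+ 2 by ring.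
by rewrite mulrn_wge0// subr_ge0.
Qed.

(* The Hilbert direct sum; an alias is needed because the library norms the
   product type by the maximum of the norms of the components. *)
Definition hsum (R : realType) (H1 H2 : hilbertType R) : Type := (H1 * H2)%type.

Section HilbertSum.
Variables (R : realType) (H1 H2 : hilbertType R).
Local Notation C := R[i].
Local Notation V := (hsum H1 H2).

HB.instance Definition _ := GRing.Lmodule.copy V (H1 * H2)%type.

Let nm (x : V) : C := sqrtC (`|x.1| ^+ 2 + `|x.2| ^+ 2).

Let nmD (x y : V) : nm (x + y) <= nm x + nm y.
Proof.
apply: le_trans (minkowski2 _ _ _ _) => //; rewrite /nm/=.
rewrite ler_sqrtC ?nnegrE ?addr_ge0 ?exprn_ge0 ?addr_ge0//.
by rewrite lerD// lerXn2r ?nnegrE ?addr_ge0// ler_normD.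
Qed.

Let nmZ (l : C) (x : V) : nm (l *: x) = `|l| * nm x.
Proof.
rewrite /nm /= !normrZ !exprMn -mulrDr.
by rewrite sqrtCM ?nnegrE ?addr_ge0 ?exprn_ge0// exprCK.
Qed.

Let nm_eq0 (x : V) : nm x = 0 -> x = 0.
Proof.
case: x => x1 x2 /eqP; rewrite /nm sqrtC_eq0 /= paddr_eq0 ?exprn_ge0//.
by rewrite !expf_eq0/= !normr_eq0 => /andP[/eqP-> /eqP->].
Qed.

HB.instance Definition _ := Lmodule_isNormed.Build C V nmD nmZ nm_eq0.

Lemma hsum_normE (x : V) : `|x| = sqrtC (`|x.1| ^+ 2 + `|x.2| ^+ 2).
Proof. by []. Qed.

Lemma hsum_norm1 (x : V) : `|x.1| <= `|x|.
Proof.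
rewrite hsum_normE -[leLHS](@exprCK _ 2)//.
by rewrite ler_sqrtC ?nnegrE ?addr_ge0 ?exprn_ge0// lerDl exprn_ge0.
Qed.

Lemma hsum_norm2 (x : V) : `|x.2| <= `|x|.
Proof.
rewrite hsum_normE -[leLHS](@exprCK _ 2)//.
by rewrite ler_sqrtC ?nnegrE ?addr_ge0 ?exprn_ge0// lerDr exprn_ge0.
Qed.

Lemma hsum_norm_le (x : V) : `|x| <= `|x.1| + `|x.2|.
Proof.
rewrite hsum_normE -[leRHS](@exprCK _ 2) ?addr_ge0//.
rewrite ler_sqrtC ?nnegrE ?exprn_ge0 ?addr_ge0 ?exprn_ge0//.
by rewrite sqrrD addrAC lerDl mulrn_wge0// mulr_ge0.
Qed.

Let hsum_complete (F : set_system V) : ProperFilter F -> cauchy F -> cvg F.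
Proof.
move=> FF /cauchy_ballP Fc.
have /cauchy_cvg/cvg_ex[/= l1 l1P] : cauchy ((fun x : V => x.1) @ F).
  apply/cauchy_ballP => e e0; rewrite !near_map2.
  have := Fc e e0; apply: filterS => -[x y] /=; rewrite -!ball_normE/=.
  exact: le_lt_trans (hsum_norm1 (x - y)).
have /cauchy_cvg/cvg_ex[/= l2 l2P] : cauchy ((fun x : V => x.2) @ F).
  apply/cauchy_ballP => e e0; rewrite !near_map2.
  have := Fc e e0; apply: filterS => -[x y] /=; rewrite -!ball_normE/=.
  exact: le_lt_trans (hsum_norm2 (x - y)).
apply/cvg_ex; exists ((l1, l2) : V); apply/cvgrPdist_lt => e e0.
have e20 : 0 < e / 2 by rewrite divr_gt0.
have /cvgrPdist_lt/(_ _ e20) {}l1P := l1P.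
have /cvgrPdist_lt/(_ _ e20) {}l2P := l2P.
near=> x.
apply: le_lt_trans (hsum_norm_le _) _; rewrite [ltRHS]splitr ltrD//=.
  by near: x; exact: l1P.
by near: x; exact: l2P.
Unshelve. all: by end_near. Qed.

HB.instance Definition _ := Uniform_isComplete.Build V hsum_complete.

Let hinner (x y : V) : C := inner x.1 y.1 + inner x.2 y.2.

Let hinner_bilinear : bilinear_for *%R (@Num.conj C \; *%R) hinner.
Proof.
split=> [y|x] a u v; rewrite /hinner /= .
  by rewrite !linearPl /=; ring.
by rewrite !linearPr /=; ring.
Qed.

HB.instance Definition _ :=
  bilinear_isBilinear.Build _ _ _ _ _ _ hinner hinner_bilinear.

Let hinner_herm (x y : V) : hinner x y = (-1) ^+ false * Num.conj (hinner y x).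
Proof.
rewrite expr0 mul1r /hinner rmorphD/=; congr (_ + _).
  by rewrite hermC expr0 mul1r.
by rewrite hermC expr0 mul1r.
Qed.

HB.instance Definition _ := isHermitianSesquilinear.Build _ _ _ _ _ hinner_herm.

Let hinner_gt0 (x : V) : x != 0 -> 0 < hinner x x.
Proof.
rewrite -normr_gt0 /hinner -!inner_norm => x0.
by rewrite -[ltRHS]sqrtCK exprn_gt0.
Qed.

HB.instance Definition _ := isDotProduct.Build _ _ hinner hinner_gt0.

Let hinner_norm (x : V) : `|x| ^+ 2 = (hinner : {dot V for _}) x x.
Proof. by rewrite hsum_normE sqrtCK !inner_norm. Qed.

HB.instance Definition _ := NormedModule_hasInner.Build R V hinner_norm.

Lemma hsum_innerE (x y : V) : inner x y = inner x.1 y.1 + inner x.2 y.2.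
Proof. by []. Qed.

End HilbertSum.

Section Operators.
Variable R : realType.
Local Notation C := R[i].
Implicit Types H K : hilbertType R.

Record bounded_op H K := BoundedOp {
  bounded_fun :> {linear H -> K} ;
  bounded_opP : exists M : C, forall x : H, `|bounded_fun x| <= M * `|x|
}.

Definition similar_op H K (T : H -> H) (T' : K -> K) :=
  exists (W : bounded_op H K) (W' : bounded_op K H),
    [/\ cancel W W', cancel W' W & forall x, W (T x) = T' (W x)].

Definition commutant H (T : H -> H) : set (bounded_op H H) :=
  [set X | forall x, X (T x) = T (X x)].

Definition is_adjoint H (T T' : bounded_op H H) :=
  forall x y, inner (T x) y = inner x (T' y).

Definition point_spectrum H (T : bounded_op H H) : set C :=
  [set a | exists2 v, v != 0 & T v = a *: v].

(* The alias R[i]^o carries the library's topology of the complex plane. *)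
Definition spectrum H (T : bounded_op H H) : set C^o :=
  [set a | ~ exists G : bounded_op H H,
     cancel (fun x => T x - a *: x) G /\ cancel G (fun x => T x - a *: x)].

Definition boundary (A : set C^o) : set C^o := closure A `\` interior A.

Definition rank_le n H K (F : H -> K) :=
  exists f : 'I_n -> K, forall x, exists c : 'I_n -> C,
    F x = \sum_(k < n) c k *: f k.

(* Bases are indexed from 0: e k stands for the vector e_{k+1}, and likewise
   b k for b_{k+1} below. *)
Definition orthonormal_basis H (e : nat -> H) :=
  (forall j k, inner (e j) (e k) = (j == k)%:R) /\
  dense [set x | exists n (c : nat -> C), x = \sum_(k < n) c k *: e k].

Definition dim_aleph0 H := exists e : nat -> H, orthonormal_basis e.

Definition is_shift H (e : nat -> H) (S : bounded_op H H) :=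
  forall k, S (e k) = e k.+1.

Definition line_proj H (e : nat -> H) (k : nat) (x : H) : H :=
  inner x (e k) *: e k.

Definition is_diagonal H (e : nat -> H) (d : nat -> C) (T : H -> H) :=
  forall x, series (fun k => d k *: line_proj e k x) @ \oo --> T x.

Definition transitive_ops H (L : set (bounded_op H H)) :=
  forall x : H, x != 0 -> dense [set X x | X in L].

Definition hsum3 H : hilbertType R := hsum H (hsum H H).

Definition inj3 H (j : 'I_3) (x : H) : hsum3 H :=
  (x *+ (j == 0), (x *+ (j == 1), x *+ (j == 2))).

Definition proj3 H (i : 'I_3) (x : hsum3 H) : H :=
  nth 0 [:: x.1; x.2.1; x.2.2] i.

(* With rows and columns numbered from 0, block Q 2 0 is the entry Q_{3,1}. *)
Definition block H (Q : hsum3 H -> hsum3 H) (i j : 'I_3) : H -> H :=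
  fun x => proj3 i (Q (inj3 j x)).

Definition corner_ops H (T : bounded_op (hsum3 H) (hsum3 H)) :
    set (bounded_op H H) :=
  [set X | exists2 Q, commutant T Q & forall x, X x = block Q 2 0 x].

Definition proj_E3 H (e : nat -> H) (r : nat) (x : H) : H :=
  \sum_(i < 3) line_proj e (r + i) x.

(* The matrices, in the basis (e_r, e_{r+1}, e_{r+2}), of the compressions of
   the elements of L to the span of these vectors. *)
Definition cross_section H (e : nat -> H) (L : set (bounded_op H H)) (r : nat) :
    set 'M[C]_3 :=
  [set M | exists2 X, L X &
     forall j : 'I_3,
       proj_E3 e r (X (e (r + j)%N)) = \sum_(i < 3) M i j *: e (r + i)%N].

End Operators.

Section Normality.
Variable R : realType.
Local Notation C := R[i].
Implicit Types (b x y q : C) (L : set 'M[C]_3).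

Definition mx3 (rows : seq (seq C)) : 'M[C]_3 :=
  \matrix_(i, j) (nth [::] rows i)`_j.

Definition has_basis L (s : seq 'M[C]_3) :=
  exists V : {vspace 'M[C]_3},
    [/\ L = [set M | M \in V], \dim V = size s & basis_of V s].

Definition bDelta1 b1 b2 b3 := b3^-1 - b2^-1.
Definition bDelta2 b1 b2 b3 := b3^-1 - b1^-1.
Definition bDelta3 b1 b2 b3 := b2^-1 - b1^-1.

Definition L1_mx x y := mx3 [:: [:: 1; 0; 0]; [:: x; 0; 0]; [:: y; 0; 0]].

Definition L2_mx b1 b2 b3 x y :=
  mx3 [:: [:: 0; 1; 0];
          [:: bDelta3 b1 b2 b3 * x; x; 0];
          [:: bDelta2 b1 b2 b3 * y; y; 0]].

Definition type1_basis b1 b2 b3 x y : seq 'M[C]_3 :=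
  let d2 := bDelta2 b1 b2 b3 in let d3 := bDelta3 b1 b2 b3 in
  [:: L1_mx x y; L2_mx b1 b2 b3 x y;
      mx3 [:: [:: 0; 0; 1]; [:: 0; 0; 0]; [:: 0; 0; 0]];
      mx3 [:: [:: 0; 0; 0]; [:: d3 / b2; d3; 1]; [:: 0; 0; 0]];
      mx3 [:: [:: 0; 0; 0]; [:: 0; 0; 0]; [:: d2 / b3; d2; 1]]].

Definition type2_basis b1 b2 b3 x y q (q' : C) : seq 'M[C]_3 :=
  let d1 := bDelta1 b1 b2 b3 in let d2 := bDelta2 b1 b2 b3 in
  let d3 := bDelta3 b1 b2 b3 in
  [:: L1_mx x y; L2_mx b1 b2 b3 x y;
      mx3 [:: [:: 0; 0; 1];
              [:: q'; q; 0];
              [:: q' * y / x + d1 * q * y / x; q * y / x; 0]];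
      mx3 [:: [:: 0; 0; 0];
              [:: d3 / b2 - q' / x; d3 - q / x; 1];
              [:: 0; 0; 0]];
      mx3 [:: [:: 0; 0; 0];
              [:: 0; 0; 0];
              [:: d2 / b3 - d1 * q / x - q' / x; d2 - q / x; 1]]].

Definition strong_basis b1 b2 b3 x y q : seq 'M[C]_3 :=
  [:: L1_mx x y; L2_mx b1 b2 b3 x y;
      mx3 [:: [:: 0; 0; 1]; [:: q / b2; q; 0]; [:: - y / (b1 * b3); - y / b1; 0]];
      mx3 [:: [:: 0; 0; 0]; [:: 1 / b2 ^+ 2; 1 / b2; 1]; [:: 0; 0; 0]];
      mx3 [:: [:: 0; 0; 0]; [:: 0; 0; 0]; [:: 1 / b3 ^+ 2; 1 / b3; 1]]].

Definition Delta_normal b1 b2 b3 L :=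
  (exists x y, [/\ x != 0, y != 0 & has_basis L (type1_basis b1 b2 b3 x y)]) \/
  (exists x y q q',
     [/\ x != 0, y != 0, q != 0 & has_basis L (type2_basis b1 b2 b3 x y q q')]).

Definition strongly_Delta_normal b1 b2 b3 x y q L :=
  [/\ x != 0, y != 0, q != 0 & has_basis L (strong_basis b1 b2 b3 x y q)].

Definition D_normal (H : hilbertType R) (e : nat -> H) (b : nat -> C)
    (L : set (bounded_op H H)) :=
  forall r, Delta_normal (b r) (b r.+1) (b r.+2) (cross_section e L r).

End Normality.

(* Main.v *)
Require Import Defs.
From mathcomp Require Import all_boot all_order all_algebra.
From mathcomp Require Import complex.
From mathcomp Require Import all_classical all_reals topology normedtype sequences.
From mathcomp Require Import ring.

Set Implicit Arguments.
Unset Strict Implicit.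
Unset Printing Implicit Defensive.

Import Order.TTheory GRing.Theory Num.Theory.
Import numFieldNormedType.Exports.

Local Open Scope classical_set_scope.
Local Open Scope ring_scope.

(** Normality leaves the parameters q and q' of a window free; the rank condition
on D X - X S, read off inside the window, pins them to the values of strong
normality.

For a window starting at r and M the matrix of the compression of an operator X
of the corner space, the entries of D X - X S in the rows r, r+1, r+2 and the
columns r, r+1 are b_i M_(i,j) - M_(i,j+1), hence only involve M; this uses
[inner_diagonal], i.e. that D acts diagonally on coordinates, and the shift
relation.  As D X - X S has rank at most one, the corresponding 2-by-2 minors
vanish ([cross_section_minor]).  This condition is quadratic in M whereas the
windows form a linear space, so it can be polarized: testing it on L_1 + Q_1 and
on L_1 - Q_1 forces q = - x / b_1 and q' = q / b_2 in the basis of the second type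
([minors_type2]).  The first type is the degenerate case q = q' = 0 of the second
([type1_basisE]), so it is excluded by the same computation, since x <> 0.  For
these values of q and q' the basis of the second type is literally the strong
one ([type2_basis_strong]).

Two consecutive windows share a 2-by-2 block: the lower right block of the first
is the upper left block of the second.  The lower right block of any matrix of
the first window satisfies one linear relation, with coefficients x_r and y_r
([type2_lower_block]).  Lifting the matrix L_1 of the second window to an
operator X, whose first window then has the lower right block with rows
(1, 0) and (x_(r+1), 0), this relation reads x_r x_(r+1) = y_r. *)

(** * Coordinates with respect to an orthonormal family *)

Section Coordinates.
Variables (R : realType) (H : hilbertType R).
Implicit Types (u v : H) (e : nat -> H) (d : nat -> R[i]).

(** Bessel's inequality for one vector: the square of the norm of
[u - inner u v *: v] is [`|u| ^+ 2 - `|inner u v| ^+ 2].  It gives the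
continuity of the coordinate functionals. *)
Lemma ler_inner_unit u v : inner v v = 1 -> `|inner u v| <= `|u|.
Proof.
move=> v1; rewrite -(@ler_pXn2r _ 2) ?nnegrE// -subr_ge0 normCK inner_norm.
have : 0 <= `|u - inner u v *: v| ^+ 2 by rewrite exprn_ge0.
rewrite inner_norm linearBl /= !linearBr /= !linearZl /= !linearZr /= v1.
have -> : inner v u = (inner u v)^*%R by rewrite hermC expr0 mul1r.
by congr (0 <= _); rewrite /=; ring.
Qed.

Lemma inner_diagonal e d (T : H -> H) u i :
  (forall j k, inner (e j) (e k) = (j == k)%:R) ->
  is_diagonal e d T -> inner (T u) (e i) = d i * inner u (e i).
Proof.
move=> eo /(_ u) /cvgrPdist_lt Tu; apply/eqP; rewrite -subr_eq0 -normr_le0.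
apply/idPn; rewrite normr_le0 -normr_gt0 => eps0.
(* From the index i.+1 on, every partial sum already contains its i-th term. *)
have [N _ /(_ (maxn N i.+1) (leq_maxl _ _)) /=] := Tu _ eps0.
set s := series _ _ => dist.
have sE : inner s (e i) = d i * inner u (e i).
  rewrite /s /series /= linear_sumlz big_mkord /=.
  have lt_i : (i < maxn N i.+1)%N by rewrite leq_max leqnn orbT.
  rewrite (bigD1 (Ordinal lt_i)) //= big1 => [|k ki].
    by rewrite /line_proj !linearZl_LR /= eo eqxx mulr1 addr0.
  rewrite /line_proj !linearZl_LR /= eo.
  by have /negPf -> : (k : nat) != i by []; rewrite !mulr0.
suff : `|inner (T u) (e i) - d i * inner u (e i)| <= `|T u - s|.
  by move=> /le_lt_trans/(_ dist); rewrite ltxx.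
rewrite -sE -linearBl; apply: ler_inner_unit.
by rewrite eo eqxx.
Qed.

Lemma rank_le1_minor (F : H -> H) u u' v v' : rank_le 1 F ->
  inner (F u) v * inner (F u') v' = inner (F u') v * inner (F u) v'.
Proof.
case=> f fP; have [c ->] := fP u; have [c' ->] := fP u'.
by rewrite !big_ord1 !linearZl_LR /=; ring.
Qed.

Lemma cross_sectionP e (L : set (bounded_op H H)) r M :
  (forall j k, inner (e j) (e k) = (j == k)%:R) ->
  cross_section e L r M <->
  exists2 X, L X & M = \matrix_(i, j) inner (X (e (r + j)%N)) (e (r + i)%N).
Proof.
move=> eo; split=> -[X LX MX]; exists X => //.
  apply/matrixP => i j; rewrite mxE.
  have inner_sum (c : 'I_3 -> R[i]) :
      inner (\sum_k c k *: e (r + k)%N) (e (r + i)%N) = c i.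
    rewrite linear_sumlz /= (bigD1 i) //= big1 => [|k ki].
      by rewrite linearZl_LR /= eo eqxx mulr1 addr0.
    rewrite linearZl_LR /= eo eqn_add2l.
    by have /negPf -> : (k : nat) != i by []; rewrite mulr0.
  by rewrite -[LHS](inner_sum (fun k => M k j)) -MX inner_sum.
by move=> j; apply: eq_bigr => i _; rewrite MX mxE.
Qed.

(** Minor of [D X - X S] in the rows and columns [r], [r.+1]: multiplying by the
shift moves the columns of [X] by one, so these four entries of [D X - X S] are
computed from the entries of [X] inside the window. *)
Lemma cross_section_minor e (S D : H -> H) d (L : set (bounded_op H H)) r M :
  (forall j k, inner (e j) (e k) = (j == k)%:R) ->
  (forall k, S (e k) = e k.+1) ->
  (forall u k, inner (D u) (e k) = d k * inner u (e k)) ->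
  (forall X, L X -> rank_le 1 (fun v => D (X v) - X (S v))) ->
  cross_section e L r M ->
  (d r * M 0 0 - M 0 1) * (d r.+1 * M 1 1 - M 1 2%:R) =
  (d r * M 0 1 - M 0 2%:R) * (d r.+1 * M 1 0 - M 1 1).
Proof.
move=> eo Se De rk /(cross_sectionP _ _ _ eo)[X LX ->].
rewrite !mxE /= !addn0 !addn1 addn2.
have := rank_le1_minor (e r) (e r.+1) (e r) (e r.+1) (rk _ LX).
by rewrite !Se !linearBl /= !De.
Qed.

End Coordinates.

(** * Algebra of a single window *)

Section Window.
Variable R : realType.
Implicit Types (b x y q : R[i]) (L : set 'M[R[i]]_3).

Lemma has_basis_sum L s M : has_basis L s -> L M ->
  exists c : nat -> R[i],
    forall i j, M i j = \sum_(k < size s) c k * s`_k i j.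
Proof.
move=> [V [-> _ bV]] /= MV.
pose c k := if insub k is Some i then coord (in_tuple s) i M else 0.
exists c => i j; rewrite {1}(coord_basis (bV : basis_of V (in_tuple s)) MV).
by rewrite summxE; apply: eq_bigr => k _; rewrite mxE /c valK.
Qed.

Lemma has_basisD L s c M N :
  has_basis L s -> M \in s -> N \in s -> L (M + c *: N).
Proof.
move=> [V [-> _ bV]] /(basis_mem bV) MV /(basis_mem bV) NV.
by rewrite /=; apply: rpredD => //; apply: rpredZ.
Qed.

Lemma type1_basisE b1 b2 b3 x y :
  type1_basis b1 b2 b3 x y = type2_basis b1 b2 b3 x y 0 0.
Proof. by rewrite /type1_basis /type2_basis !(mul0r, mulr0, subr0, addr0). Qed.

Lemma Delta_normal_type2 b1 b2 b3 L : Delta_normal b1 b2 b3 L ->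
  exists x y q q',
    [/\ x != 0, y != 0 & has_basis L (type2_basis b1 b2 b3 x y q q')].
Proof.
case=> [[x [y [x0 y0]]]|[x [y [q [q' [x0 y0 _ h]]]]]].
  by rewrite type1_basisE => h; exists x, y, 0, 0.
by exists x, y, q, q'.
Qed.

Lemma type2_basis_strong b1 b2 b3 x y :
  b1 != 0 -> b2 != 0 -> b3 != 0 -> x != 0 ->
  type2_basis b1 b2 b3 x y (- x / b1) (- x / b1 / b2) =
  strong_basis b1 b2 b3 x y (- x / b1).
Proof.
move=> b10 b20 b30 x0.
rewrite /type2_basis /strong_basis /bDelta1 /bDelta2 /bDelta3.
do !congr (_ :: _); congr mx3; do !congr (_ :: _);
  by field; rewrite ?b10 ?b20 ?b30 ?x0.
Qed.

(** The minor of [L_1 + t Q_1] is a quadratic polynomial in [t] without constant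
term, so its two coefficients are recovered from [t = 1] and [t = -1]. *)
Lemma minors_type2 b1 b2 b3 x y q q' L :
  b1 != 0 -> b2 != 0 -> has_basis L (type2_basis b1 b2 b3 x y q q') ->
  (forall M, L M ->
    (b1 * M 0 0 - M 0 1) * (b2 * M 1 1 - M 1 2%:R) =
    (b1 * M 0 1 - M 0 2%:R) * (b2 * M 1 0 - M 1 1)) ->
  q = - x / b1 /\ q' = - x / b1 / b2.
Proof.
move=> b10 b20 LE minor.
set A := b2 * (b1 * q + x); set B := b2 * q' - q.
have pencil t : t * A + t ^+ 2 * B = 0.
  have /minor : L (L1_mx x y + t *: mx3 [:: [:: 0; 0; 1]; [:: q'; q; 0];
      [:: q' * y / x + bDelta1 b1 b2 b3 * q * y / x; q * y / x; 0]]).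
    by apply: has_basisD LE _ _; rewrite !inE eqxx ?orbT.
  rewrite !mxE /= => minor_t.
  transitivity ((b1 * (1 + t * 0) - (0 + t * 0)) * (b2 * (0 + t * q) - (0 + t * 0))
    - (b1 * (0 + t * 0) - (0 + t * 1)) * (b2 * (x + t * q') - (0 + t * q))).
    by rewrite /A /B; ring.
  by rewrite minor_t subrr.
have two0 : 2 != 0 :> R[i] by rewrite pnatr_eq0.
have /eqP : A = 0.
  apply: (mulfI two0); rewrite mulr0.
  transitivity (1 * A + 1 ^+ 2 * B - (-1 * A + (-1) ^+ 2 * B)); first by ring.
  by rewrite !pencil subrr.
rewrite mulf_eq0 (negPf b20) /= addr_eq0 => /eqP qx.
have qE : q = - x / b1 by rewrite -qx mulrC mulKf.
have /eqP : B = 0.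
  apply: (mulfI two0); rewrite mulr0.
  transitivity (1 * A + 1 ^+ 2 * B + (-1 * A + (-1) ^+ 2 * B)); first by ring.
  by rewrite !pencil addr0.
rewrite subr_eq0 => /eqP q'q.
by split=> //; rewrite -qE -q'q mulrC mulKf.
Qed.

(** In the lower right 2-by-2 block, [L_1] vanishes and [L_2], [Q_1] are both
multiples of the matrix with columns [(x, y)] and [(0, 0)].  The five basis
matrices thus have blocks in a space of dimension 3, whose equation this is. *)
Lemma type2_lower_block b1 b2 b3 x y q q' L M : x != 0 ->
  has_basis L (type2_basis b1 b2 b3 x y q q') -> L M ->
  x * (M 2%:R 1 - (bDelta2 b1 b2 b3 - q / x) * M 2%:R 2%:R) =
  y * (M 1 1 - (bDelta3 b1 b2 b3 - q / x) * M 1 2%:R).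
Proof.
move=> x0 LE /(has_basis_sum LE)[c ME].
rewrite !ME !big_ord_recr !big_ord0 /= !mxE /=.
by field.
Qed.

End Window.

(** * The windows of the corner space *)

(** Windows are images of one and the same space of operators, so a matrix of one
window comes from an operator, which then has a matrix in the previous window. *)
Lemma cross_section_overlap (R : realType) (H : hilbertType R) (e : nat -> H)
    (L : set (bounded_op H H)) r M :
  (forall j k, inner (e j) (e k) = (j == k)%:R) ->
  cross_section e L r.+1 M ->
  exists2 M', cross_section e L r M' &
    [/\ M' 1 1 = M 0 0, M' 1 2%:R = M 0 1,
        M' 2%:R 1 = M 1 0 & M' 2%:R 2%:R = M 1 1].
Proof.
move=> eo /(cross_sectionP _ _ _ eo)[X LX ->].
exists (\matrix_(i, j) inner (X (e (r + j)%N)) (e (r + i)%N)).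
  by apply/(cross_sectionP _ _ _ eo); exists X.
by split; rewrite !mxE /= ?addn0 ?addn1 ?addn2.
Qed.

Theorem theorem6 (R : realType) (H1 H2 H : hilbertType R)
  (dimH1 : dim_aleph0 H1) (dimH2 : dim_aleph0 H2)
  (e : nat -> H) (he : orthonormal_basis e)
  (S : bounded_op H H) (hS : is_shift e S)
  (A : bounded_op H1 H1) (C : bounded_op H2 H1) (B : bounded_op H2 H2)
  (T Tstar : bounded_op (hsum H1 H2) (hsum H1 H2))
  (hT : forall (x : H1) (y : H2), T (x, y) = (A x + C y, B y))
  (hA : similar_op A S)
  (hTstar : is_adjoint T Tstar)
  (hTp : point_spectrum Tstar = set0)
  (hTdense : forall x : H1, x != 0 ->
    dense [set X (x, 0) | X in commutant T])
  (b0 : R[i]) (hb0 : boundary (spectrum B) b0)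
  (b : nat -> R[i])
  (hb_res : forall k, (~` spectrum B) (b k))
  (hb_lim : (b : nat -> R[i]^o) @ \oo --> (b0 : R[i]^o))
  (hb_inj : injective b)
  (hb_neq0 : forall k, b k != 0)
  (Fstar Dstar : bounded_op H H)
  (hDstar : is_diagonal e (fun k => b k - b0) Dstar)
  (hFstar : rank_le 1 Fstar)
  (That : bounded_op (hsum3 H) (hsum3 H))
  (hThat : similar_op (fun x => T x - b0 *: x) That)
  (hThat11 : forall v, block That 0 0 v = S v - b0 *: v)
  (hThat21 : forall v, block That 1 0 v = 0)
  (hThat31 : forall v, block That 2 0 v = 0)
  (hThat32 : forall v, block That 2 1 v = Fstar v)
  (hThat33 : forall v, block That 2 2 v = Dstar v)
  (htrans : transitive_ops (corner_ops That))
  (hrank : forall X, corner_ops That X ->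
    let D := fun v => Dstar v + b0 *: v in
    rank_le 1 (fun v => D (X v) - X (S v)))
  (hnormal : D_normal e b (corner_ops That)) :
  exists x y q : nat -> R[i],
    (forall r, strongly_Delta_normal (b r) (b r.+1) (b r.+2)
       (x r) (y r) (q r) (cross_section e (corner_ops That) r)) /\
    (forall r, x r.+1 = y r / x r).
Proof.
have [eo _] := he; set L := corner_ops That.
have DE u k : inner (Dstar u + b0 *: u) (e k) = b k * inner u (e k).
  rewrite linearDl /= linearZl_LR /= (inner_diagonal _ _ eo hDstar).
  by rewrite -mulrDl subrK.
have window r : exists xy : R[i] * R[i], [/\ xy.1 != 0, xy.2 != 0 &
    has_basis (cross_section e L r)
      (type2_basis (b r) (b r.+1) (b r.+2) xy.1 xy.2
         (- xy.1 / b r) (- xy.1 / b r / b r.+1))].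
  have [x [y [q [q' [x0 y0 LE]]]]] := Delta_normal_type2 (hnormal r).
  have [] := minors_type2 (hb_neq0 _) (hb_neq0 _) LE.
    by move=> M; apply: (cross_section_minor eo hS DE).
  by move=> qE q'E; exists (x, y); rewrite -q'E -qE.
have [xy xyP] := choice window.
exists (fun r => (xy r).1), (fun r => (xy r).2), (fun r => - (xy r).1 / b r).
split=> r; have [x0 y0 LE] := xyP r.
  rewrite /strongly_Delta_normal -type2_basis_strong //.
  by split=> //; rewrite mulf_neq0 ?oppr_eq0 ?invr_eq0.
have [_ _ LE'] := xyP r.+1.
have L1r : cross_section e L r.+1 (L1_mx (xy r.+1).1 (xy r.+1).2).
  by have [V [-> _ bV]] := LE'; apply: (basis_mem bV); rewrite mem_head.
have [M Mr [M11 M12 M21 M22]] := cross_section_overlap eo L1r.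
have := type2_lower_block x0 LE Mr.
rewrite M11 M12 M21 M22 !mxE /= !mulr0 !subr0 mulr1 => <-.
by rewrite mulrC mulKf.
Qed.
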